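(* For every integer $k\geq 7$, the lower density threshold of $k$-Visits is at most $5/6+1/\lfloor (k-1)/6\rfloor$; that is, there exist instances $D$ with density arbitrarily close to (from above) or at most $5/6+1/\lfloor (k-1)/6\rfloor$ that admit no $k$-Visits schedule, so no $\delta>5/6+1/\lfloor (k-1)/6\rfloor$ has the property that all instances of density at most $\delta$ admit a $k$-Visits schedule.
   Context: $k$-Visits: given a multiset of positive integers (deadlines) $D=\{d_1,\ldots,d_n\}$, decide whether there is a sequence of length $nk$ with entries in $[n]$, containing each $i$ exactly $k$ times, such that the first occurrence of $i$ is within the first $d_i$ positions and every later occurrence of $i$ is at most $d_i$ positions after the previous one. The density of $D$ is $\mathrm{Dens}(D)=\sum_i 1/d_i$. The lower density threshold of $k$-Visits is the largest value $\delta$ such that every instance with density at most $\delta$ admits a $k$-Visits schedule. *)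

(* Defs.v *)
From HB Require Import structures.
From mathcomp Require Import all_boot all_order all_algebra.
From mathcomp Require Import reals.
Set Implicit Arguments.
Unset Strict Implicit.
Unset Printing Implicit Defensive.

Import Order.TTheory GRing.Theory Num.Theory.
Local Open Scope ring_scope.

(* A multiset of deadlines is given by a list, in an arbitrary order; the
   tasks are the indices of that list, so repeated deadlines are distinct
   tasks. *)
Definition is_instance (D : seq nat) : Prop := all (fun d => 0 < d)%N D.

Definition deadline (D : seq nat) (i : 'I_(size D)) : nat := nth 0%N D i.

Definition dens (R : realType) (D : seq nat) : R := \sum_(d <- D) d%:R^-1.

(* Positions are counted from 0, so "within the first d positions" is
   [p < d]. *)
Definition is_schedule (k : nat) (D : seq nat)
    (s : (size D * k).-tuple 'I_(size D)) : Prop :=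
  [/\ forall i, count_mem i s = k,
      forall (i : 'I_(size D)) (p : 'I_(size D * k)),
        tnth s p = i ->
        (forall r : 'I_(size D * k), (r < p)%N -> tnth s r != i) ->
        (p < deadline i)%N
    & forall (i : 'I_(size D)) (p q : 'I_(size D * k)),
        (p < q)%N -> tnth s p = i -> tnth s q = i ->
        (forall r : 'I_(size D * k), (p < r < q)%N -> tnth s r != i) ->
        (q - p <= deadline i)%N].

Definition schedulable (k : nat) (D : seq nat) : Prop :=
  exists s : (size D * k).-tuple 'I_(size D), is_schedule s.

Definition density_guarantee (R : realType) (k : nat) (delta : R) : Prop :=
  forall D : seq nat, is_instance D -> dens R D <= delta -> schedulable k D.

Definition is_lower_density_threshold (R : realType) (k : nat) (delta : R)
    : Prop :=
  density_guarantee k delta /\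
  forall delta' : R, density_guarantee k delta' -> delta' <= delta.

(* Main.v *)
(* The deadlines 2, 3 and m cannot coexist: a later visit of the task with
   deadline m at a position [p > 0] forces the task with deadline 2 into both
   positions [p - 1] and [p + 1], which leaves three consecutive positions
   without the task with deadline 3.  The argument only needs tasks that are
   not yet finished, and no task is finished before position k. *)
Require Import Defs.
From HB Require Import structures.
From mathcomp Require Import all_boot all_order all_algebra.
From mathcomp Require Import reals.
From mathcomp Require Import zify ring.
Set Implicit Arguments.
Unset Strict Implicit.
Unset Printing Implicit Defensive.

Import Order.TTheory GRing.Theory Num.Theory.
Local Open Scope ring_scope.

(** The first [a] positions can hold at most [a] of the occurrences. *)
Lemma visit_after (n : nat) (T : eqType) (s : n.-tuple T) (x : T) (a : nat) :
  (a < count_mem x s)%N -> exists q : 'I_n, (a <= q)%N /\ tnth s q = x.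
Proof.
rewrite -{1}(cat_take_drop a s) count_cat => lt_a.
have le_take : (count_mem x (take a s) <= a)%N.
  by rewrite (leq_trans (count_size _ _)) // size_take_min geq_minl.
have : has (pred1 x) (drop a s) by rewrite has_count; lia.
case/(has_nthP x) => j; rewrite size_drop size_tuple nth_drop => lt_j /eqP xE.
have lt_aj : (a + j < n)%N by lia.
by exists (Ordinal lt_aj); rewrite leq_addr (tnth_nth x).
Qed.

(** Turns the two deadline conditions into one: every window of [deadline i] positions starting
    before position [k] meets task [i]. The bound [a < k] ensures that a visit is still due. *)
Lemma visit_in_window (k : nat) (D : seq nat)
    (s : (size D * k).-tuple 'I_(size D)) (i : 'I_(size D)) (a : nat) :
  is_schedule s -> (a < k)%N ->
  exists q : 'I_(size D * k),
    (a <= q < a + deadline i)%N /\ tnth s q = i.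
Proof.
move=> [cnt first_visit next_visit] lt_ak.
have [q0 [le_aq0 q0E]] : exists q : 'I_(size D * k), (a <= q)%N /\ tnth s q = i.
  by apply: visit_after; rewrite cnt.
pose P (q : 'I_(size D * k)) := (a <= q)%N && (tnth s q == i).
have P0 : P q0 by rewrite /P le_aq0 q0E eqxx.
case: (arg_minnP (fun q => val q) P0) => q /andP[le_aq /eqP qE] q_min.
exists q; split=> //; rewrite le_aq /=.
have no_visit (r : 'I_(size D * k)) : (a <= r < q)%N -> tnth s r != i.
  case/andP=> le_ar lt_rq; apply/negP => rE.
  by have := q_min r; rewrite /P le_ar rE => /(_ isT); rewrite leqNgt lt_rq.
pose Q (r : 'I_(size D * k)) := (r < a)%N && (tnth s r == i).
case: (pickP Q) => [r0 Q0 | noQ].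
  (* The last visit [r] before [a] and the first visit [q] from [a] on are consecutive, so
     [q <= r + deadline i < a + deadline i]. *)
  case: (arg_maxnP (fun r => val r) Q0) => r /andP[lt_ra /eqP rE] r_max.
  have le_gap : (q - r <= deadline i)%N.
    apply: next_visit rE qE _; first exact: leq_trans lt_ra le_aq.
    move=> t /andP[lt_rt lt_tq]; case: (leqP a t) => [le_at | lt_ta].
      by apply: no_visit; rewrite le_at.
    apply/negP => tE; have := r_max t.
    by rewrite /Q lt_ta tE => /(_ isT) /=; rewrite leqNgt lt_rt.
  lia.
(* Without a visit before [a], [q] is the very first visit. *)
apply: leq_trans (leq_addl _ _); apply: first_visit qE _ => t lt_tq.
case: (leqP a t) => [le_at | lt_ta]; first by apply: no_visit; rewrite le_at.
by apply/negP => tE; have := noQ t; rewrite /Q lt_ta tE.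
Qed.

Lemma not_schedulable_2_3 (k m : nat) :
  (1 < k)%N -> (m < k)%N -> ~ schedulable k [:: 2; 3; m]%N.
Proof.
move=> lt1k lt_mk [s sched].
have window := visit_in_window _ sched.
pose A : 'I_(size [:: 2; 3; m]%N) := @Ordinal 3 0 isT.
pose B : 'I_(size [:: 2; 3; m]%N) := @Ordinal 3 1 isT.
pose C : 'I_(size [:: 2; 3; m]%N) := @Ordinal 3 2 isT.
(* Starting at 1 makes [p.-1] a true predecessor; [p <= m < k] allows windows at [p.-1] and [p]. *)
have [p [p_bound pC]] := window C 1%N lt1k.
have {}p_bound : (1 <= p < 1 + m)%N := p_bound.
have lt_p1k : (p.-1 < k)%N by lia.
have lt_pk : (p < k)%N by lia.
have [q [q_bound qA]] := window A _ lt_p1k.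
have {}q_bound : (p.-1 <= q < p.-1 + 2)%N := q_bound.
have [r [r_bound rA]] := window A _ lt_pk.
have {}r_bound : (p <= r < p + 2)%N := r_bound.
have [t [t_bound tB]] := window B _ lt_p1k.
have {}t_bound : (p.-1 <= t < p.-1 + 3)%N := t_bound.
have neq_pos x y u v : tnth s x = u -> tnth s y = v -> u != v ->
    (x : nat) <> y.
  by move=> <- <- /eqP neq /val_inj exy; apply: neq; rewrite exy.
have neq_qp := neq_pos _ _ _ _ qA pC isT.
have neq_rp := neq_pos _ _ _ _ rA pC isT.
have neq_tp := neq_pos _ _ _ _ tB pC isT.
have neq_tq := neq_pos _ _ _ _ tB qA isT.
have neq_tr := neq_pos _ _ _ _ tB rA isT.
(* As [p] is taken by [C], [q = p - 1] and [r = p + 1], so no value is left for [t]. *)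
lia.
Qed.

Lemma dens_2_3 (R : realType) (m : nat) :
  dens R [:: 2; 3; m]%N = 5 / 6 + m%:R^-1.
Proof.
rewrite /dens !big_cons big_nil addr0 addrA; congr (_ + _).
by field.
Qed.

Theorem theorem12 (R : realType) (k : nat) (hk : (7 <= k)%N) :
  [/\ forall delta : R, is_lower_density_threshold k delta ->
        delta <= 5 / 6 + (((k - 1) %/ 6)%N)%:R^-1,
      forall eps : R, 0 < eps ->
        exists D : seq nat,
          [/\ is_instance D,
              dens R D < 5 / 6 + (((k - 1) %/ 6)%N)%:R^-1 + eps
            & ~ schedulable k D]
    & forall delta : R, 5 / 6 + (((k - 1) %/ 6)%N)%:R^-1 < delta ->
        ~ density_guarantee k delta].
Proof.
set m := ((k - 1) %/ 6)%N.
have m_gt0 : (0 < m)%N by rewrite /m; lia.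
have lt_mk : (m < k)%N by rewrite /m; lia.
have inst : is_instance [:: 2; 3; m]%N by rewrite /is_instance /= m_gt0.
have unsched : ~ schedulable k [:: 2; 3; m]%N.
  by apply: not_schedulable_2_3 => //; apply: leq_trans hk.
have no_guarantee (delta : R) :
    5 / 6 + m%:R^-1 < delta -> ~ density_guarantee k delta.
  by move=> lt_delta G; apply/unsched/G; rewrite // dens_2_3 ltW.
split=> // [delta [G _] | eps eps_gt0].
  by rewrite leNgt; apply/negP => /no_guarantee.
(* The density equals the bound exactly, so one instance serves every [eps]. *)
by exists [:: 2; 3; m]%N; rewrite dens_2_3 ltrDl.
Qed.
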